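(* Let $(X,G)$ be a complete $G$-metric space, let $\phi:X\to\mathbb{R}$ be a function that is bounded from above, and let $\preceq$ be the preorder on $X$ induced by $\phi$, i.e. $x\preceq y \Longleftrightarrow G(x,y,y)\le \phi(y)-\phi(x)$. Let $n\ge 2$ and let $F:X^n\to X$ and $g:X\to X$ be two sequentially continuous mappings such that the pair $\{F,g\}$ is weakly related. Suppose there exist $n$ elements $x_0^1,\dots,x_0^n\in X$ with $$x_0^i\preceq F(x_0^i,x_0^{i+1},\dots,x_0^n,x_0^1,\dots,x_0^{i-1})\quad\text{for all } i,\ 1\le i\le n.$$ Then $F$ and $g$ have a common $n$-tuple fixed point in $X^n$.
   Context: A $G$-metric space $(X,G)$ is a nonempty set $X$ with a function $G:X\times X\times X\to[0,\infty)$ such that: (G1) $G(x,y,z)=0$ if $x=y=z$; (G2) $G(x,x,y)>0$ whenever $x\ne y$; (G3) $G(x,x,y)\le G(x,y,z)$ whenever $z\neq y$; (G4) $G$ is symmetric in all three variables; (G5) $G(x,y,z)\le G(x,a,a)+G(a,y,z)$ for all $x,y,z,a\in X$. A sequence $(x_l)$ in $X$ $G$-converges to $x\in X$ (written $x_l\to x$) if $\lim_{l,m\to\infty}G(x,x_l,x_m)=0$. It is $G$-Cauchy if $G(x_l,x_m,x_k)\to 0$ as $l,m,k\to\infty$. The space $(X,G)$ is complete if every $G$-Cauchy sequence $G$-converges to a point of $X$. A mapping $g:X\to X$ is sequentially continuous if $x_l\to x$ implies $gx_l\to gx$. A mapping $F:X^n\to X$ is sequentially continuous if, whenever $x_l^i\to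 x^{*,i}$ as $l\to\infty$ for each $i=1,\dots,n$, one has $F(x_l^i,x_l^{i+1},\dots,x_l^n,x_l^1,\dots,x_l^{i-1})\to F(x^{*,i},x^{*,i+1},\dots,x^{*,n},x^{*,1},\dots,x^{*,i-1})$. The pair $\{F,g\}$, with $F:X^n\to X$ and $g:X\to X$, is weakly related if for all $(x^1,\dots,x^n)\in X^n$ and all $1\le i\le n$, $$F(x^i,x^{i+1},\dots,x^n,x^1,\dots,x^{i-1})\preceq gF(x^i,x^{i+1},\dots,x^n,x^1,\dots,x^{i-1})$$ and $$gx^i\preceq F(gx^i,gx^{i+1},\dots,gx^n,gx^1,\dots,gx^{i-1}).$$ An element $(x^1,\dots,x^n)\in X^n$ is a common $n$-tuple fixed point of $F:X^n\to X$ and $g:X\to X$ if $F(x^i,x^{i+1},\dots,x^n,x^1,\dots,x^{i-1})=gx^i=x^i$ for all $1\le i\le n$. *)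

(* Defs.v *)
From HB Require Import structures.
From mathcomp Require Import all_boot all_order all_algebra.
From mathcomp Require Import all_classical all_reals all_analysis.

Set Implicit Arguments.
Unset Strict Implicit.
Unset Printing Implicit Defensive.

Import Order.TTheory GRing.Theory Num.Theory.
Import numFieldNormedType.Exports.

Local Open Scope classical_set_scope.
Local Open Scope ring_scope.

Record is_Gmetric (R : realType) (X : Type) (G : X -> X -> X -> R) : Prop := {
  Gmetric_inhabited : inhabited X;
  Gmetric_ge0 : forall x y z, 0 <= G x y z;
  Gmetric_refl : forall x, G x x x = 0;
  Gmetric_gt0 : forall x y, x <> y -> 0 < G x x y;
  Gmetric_le : forall x y z, z <> y -> G x x y <= G x y z;
  Gmetric_sym : forall x y z,
    [/\ G x y z = G x z y, G x y z = G y x z, G x y z = G y z x,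
        G x y z = G z x y & G x y z = G z y x];
  Gmetric_triangle : forall x y z a, G x y z <= G x a a + G a y z }.

Section GMetricSpace.
Variables (R : realType) (X : Type) (G : X -> X -> X -> R).

Definition Gcvg (u : nat -> X) (x : X) : Prop :=
  G x (u p.1) (u p.2) @[p --> (\oo, \oo)] --> (0 : R).

Definition Gcauchy (u : nat -> X) : Prop :=
  G (u p.1.1) (u p.1.2) (u p.2) @[p --> ((\oo, \oo), \oo)] --> (0 : R).

Definition Gcomplete : Prop :=
  forall u, Gcauchy u -> exists x, Gcvg u x.

Definition phi_le (phi : X -> R) (x y : X) : Prop :=
  G x y y <= phi y - phi x.

Definition seq_continuous (g : X -> X) : Prop :=
  forall u x, Gcvg u x -> Gcvg (g \o u) (g x).

End GMetricSpace.

(* Components are indexed from 0 by 'I_n, so that [rot i x] is the tuple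
   (x_i, x_(i+1), ..., x_(n-1), x_0, ..., x_(i-1)). *)
Definition Frot (X : Type) (n : nat) (F : n.-tuple X -> X) (x : n.-tuple X)
  (i : 'I_n) : X := F [tuple of rot i x].

Definition seq_continuous_tuple (R : realType) (X : Type)
    (G : X -> X -> X -> R) (n : nat) (F : n.-tuple X -> X) : Prop :=
  forall (u : nat -> n.-tuple X) (x : n.-tuple X),
    (forall i, Gcvg G (fun l => tnth (u l) i) (tnth x i)) ->
    forall i, Gcvg G (fun l => Frot F (u l) i) (Frot F x i).

Definition weakly_related (X : Type) (le : X -> X -> Prop) (n : nat)
    (F : n.-tuple X -> X) (g : X -> X) : Prop :=
  forall (x : n.-tuple X) (i : 'I_n),
    le (Frot F x i) (g (Frot F x i)) /\
    le (g (tnth x i)) (Frot F [tuple of map g x] i).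

Definition common_tuple_fixed_point (X : Type) (n : nat)
    (F : n.-tuple X -> X) (g : X -> X) (x : n.-tuple X) : Prop :=
  forall i : 'I_n, Frot F x i = g (tnth x i) /\ g (tnth x i) = tnth x i.

(* Main.v *)
(* Put Phi x = (F(x^i, ..., x^(i-1)))_i and iterate T = g o Phi from x_0, with
   g acting componentwise.  Weak relatedness makes
   a_k <= Phi a_k <= g (Phi a_k) = a_(k+1) componentwise, so phi is monotone and
   bounded along each component, which is therefore Cauchy, say a_k -> x.
   Continuity gives Phi a_k -> Phi x and a_(k+1) = g (Phi a_k) -> g (Phi x), so
   g (Phi x) = x.  As G(a_k, Phi a_k, Phi a_k) <= phi a_(k+1) - phi a_k -> 0,
   also Phi x = x, and then g x = x. *)
Require Import Defs.
From HB Require Import structures.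
From mathcomp Require Import all_boot all_order all_algebra.
From mathcomp Require Import all_classical all_reals all_analysis.
From mathcomp Require Import lra.

Set Implicit Arguments.
Unset Strict Implicit.
Unset Printing Implicit Defensive.

Import Order.TTheory GRing.Theory Num.Theory.
Import numFieldNormedType.Exports.

Local Open Scope classical_set_scope.
Local Open Scope ring_scope.

(** Some [f N] lies within [e] of the supremum, which bounds every [f k]. *)
Lemma nondecreasing_bounded_increment (R : realType) (f : nat -> R) (e : R) :
  {homo f : m k / (m <= k)%N >-> m <= k} -> has_ubound (range f) -> 0 < e ->
  exists N, forall k, f k - f N < e.
Proof.
move=> f_mono f_ub e0.
have f_sup : has_sup (range f) by split=> //; exists (f 0%N), 0%N.
have [_ [N _ <-] ltN] := sup_adherent e0 f_sup.
exists N => k; have : f k <= sup (range f) by apply: ub_le_sup => //; exists k.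
by move: ltN; lra.
Qed.

Section GMetricTheory.
Variables (R : realType) (X : Type) (G : X -> X -> X -> R).
Hypothesis G_metric : is_Gmetric G.
Implicit Types (x y z : X) (u v : nat -> X).

Lemma Gcvg_ex u x : Gcvg G u x <-> forall e, 0 < e ->
  exists N, forall l m, (N <= l)%N -> (N <= m)%N -> G x (u l) (u m) < e.
Proof.
split=> [/cvgr0Pnorm_lt ux e e0 | ux].
  have [[A B] /= [[N1 _ AN1] [N2 _ BN2]] AB] := ux e e0.
  (* A set of the product filter contains a product of two tails; the larger threshold serves both
     indices. *)
  exists (maxn N1 N2) => l m; rewrite !geq_max => /andP[l1 _] /andP[_ m2].
  apply: le_lt_trans (ler_norm _) _.
  by apply: (AB (l, m)); split; [exact: AN1 | exact: BN2].
apply/cvgr0Pnorm_lt => e e0; have [N uN] := ux e e0.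
exists ([set k | (N <= k)%N], [set k | (N <= k)%N]) => /=.
  by split; exists N.
by move=> [l m] /= [Nl Nm]; rewrite ger0_norm ?uN // Gmetric_ge0.
Qed.

Lemma Gcauchy_ex u : (forall e, 0 < e ->
    exists N, forall l m k, (N <= l)%N -> (N <= m)%N -> (N <= k)%N ->
    G (u l) (u m) (u k) < e) -> Gcauchy G u.
Proof.
move=> uC; apply/cvgr0Pnorm_lt => e e0; have [N uN] := uC e e0.
exists ([set p | (N <= p.1)%N /\ (N <= p.2)%N], [set k | (N <= k)%N]) => /=.
  split; last by exists N.
  exists ([set k | (N <= k)%N], [set k | (N <= k)%N]) => //=.
  by split; exists N.
move=> [[l m] k] /= [[Nl Nm] Nk].
by rewrite ger0_norm ?uN // Gmetric_ge0.
Qed.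

Lemma Gcvg_shift u x : Gcvg G u x -> Gcvg G (fun l => u l.+1) x.
Proof.
move=> /Gcvg_ex ux; apply/Gcvg_ex => e /ux[N uN].
by exists N => l m Nl Nm; apply: uN; apply: leqW.
Qed.

(** Going from [x] to [y] in [G x x y] costs [G x y y] and leaves [G y x y], which is the same
    number by symmetry. *)
Lemma Gmetric_swap x y : G y x x <= 2 * G x y y.
Proof.
have [_ _ _ Gxxy _] := Gmetric_sym G_metric x x y.
have [_ Gyxy _ _ _] := Gmetric_sym G_metric y x y.
by have := Gmetric_triangle G_metric x x y y; lra.
Qed.

(** Two detours through [w] split [G x y z] into three distances to [w]; each is then swapped, at
    the cost of a factor 2, into the orientation that [phi_le] controls for points above [w]. *)
Lemma Gmetric_to_point x y z w :
  G x y z <= 2 * (G w x x + G w y y + G w z z).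
Proof.
have [_ Gwyz _ _ _] := Gmetric_sym G_metric w y z.
have [_ _ _ Gwwz _] := Gmetric_sym G_metric w w z.
have := Gmetric_triangle G_metric x y z w.
have := Gmetric_triangle G_metric y w z w.
have := Gmetric_swap w x; have := Gmetric_swap w y; have := Gmetric_swap w z.
by lra.
Qed.

Lemma Gcvg_eq_limits u v x y : Gcvg G u x -> Gcvg G v y ->
  (forall e, 0 < e ->
    exists N, forall k, (N <= k)%N -> G (u k) (v k) (v k) < e) ->
  x = y.
Proof.
move=> /Gcvg_ex ux /Gcvg_ex vy uv; apply: contrapT => /nesym /(Gmetric_gt0 G_metric).
have [_ _ _ -> _] := Gmetric_sym G_metric y y x.
(* The path [x], [u k], [v k], [y] has three legs; the last must be swapped and counts twice, so
   quarters of [d] add up to the contradiction [d < d]. *)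
set d := G x y y => d0; have d4 : 0 < d / 4 by lra.
have [N1 uN1] := ux _ d4; have [N2 vN2] := vy _ d4; have [N3 uvN3] := uv _ d4.
pose k := maxn N1 (maxn N2 N3).
have [k1 k2 k3] : [/\ (N1 <= k)%N, (N2 <= k)%N & (N3 <= k)%N].
  by rewrite /k !leq_max !leqnn !orbT.
have := uN1 _ _ k1 k1; have := vN2 _ _ k2 k2; have := uvN3 _ k3.
have := Gmetric_triangle G_metric x y y (u k).
have := Gmetric_triangle G_metric (u k) y y (v k).
by have := Gmetric_swap y (v k); rewrite -/d; lra.
Qed.

Lemma Gcvg_unique u x y : Gcvg G u x -> Gcvg G u y -> x = y.
Proof.
move=> ux uy; apply: (Gcvg_eq_limits ux uy) => e e0.
by exists 0%N => k _; rewrite (Gmetric_refl G_metric).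
Qed.

Section Preorder.
Variable phi : X -> R.

Lemma phi_le_refl x : phi_le G phi x x.
Proof. by rewrite /phi_le (Gmetric_refl G_metric) subrr. Qed.

Lemma phi_le_trans y x z :
  phi_le G phi x y -> phi_le G phi y z -> phi_le G phi x z.
Proof.
by rewrite /phi_le; have := Gmetric_triangle G_metric x z z y; lra.
Qed.

Lemma phi_le_homo x y : phi_le G phi x y -> phi x <= phi y.
Proof. by move=> xy; rewrite -subr_ge0 (le_trans _ xy) // Gmetric_ge0. Qed.

Hypothesis phi_bounded : has_ubound (range phi).
Variable u : nat -> X.
Hypothesis u_incr : forall k, phi_le G phi (u k) (u k.+1).

Lemma phi_le_chain m k : (m <= k)%N -> phi_le G phi (u m) (u k).
Proof.
by move/(@homo_leq _ u _ phi_le_refl phi_le_trans u_incr).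
Qed.

Lemma phi_chain_increment e : 0 < e ->
  exists N, forall k, phi (u k) - phi (u N) < e.
Proof.
apply: (@nondecreasing_bounded_increment R (phi \o u)).
  by move=> m k /phi_le_chain/phi_le_homo.
have [M ubM] := phi_bounded.
by exists M => _ [k _ <-]; apply: ubM; exists (u k).
Qed.

Lemma phi_chain_cauchy : Gcauchy G u.
Proof.
apply: Gcauchy_ex => e e0; have e6 : 0 < e / 6 by lra.
(* Later terms lie above [u N], at distance less than [e / 6]; three such distances, doubled, stay
   below [e]. *)
have [N uN] := phi_chain_increment e6; exists N => l m k Nl Nm Nk.
have := Gmetric_to_point (u l) (u m) (u k) (u N).
have := phi_le_chain Nl; have := phi_le_chain Nm; have := phi_le_chain Nk.
by rewrite /phi_le; have := uN l; have := uN m; have := uN k; lra.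
Qed.

(** The interleaving gives [G (u k) (v k) (v k) <= phi (u k.+1) - phi (u k)], which is small for
    large [k]. *)
Lemma phi_chain_between v x y :
  (forall k, phi_le G phi (u k) (v k)) ->
  (forall k, phi_le G phi (v k) (u k.+1)) ->
  Gcvg G u x -> Gcvg G v y -> x = y.
Proof.
move=> uv vu ux vy; apply: (Gcvg_eq_limits ux vy) => e e0.
have [N uN] := phi_chain_increment e0; exists N => k Nk.
have := phi_le_homo (phi_le_chain Nk); have := phi_le_homo (vu k).
by have := uv k; rewrite /phi_le; have := uN k.+1; lra.
Qed.

End Preorder.
End GMetricTheory.

Theorem theorem3p2 (R : realType) (X : Type) (G : X -> X -> X -> R)
  (G_metric : is_Gmetric G) (G_complete : Gcomplete G)
  (phi : X -> R) (phi_bounded : has_ubound (range phi))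
  (n : nat) (n_ge2 : (2 <= n)%N)
  (F : n.-tuple X -> X) (g : X -> X)
  (F_cont : seq_continuous_tuple G F) (g_cont : seq_continuous G g)
  (Fg_related : weakly_related (phi_le G phi) F g)
  (x0_exists : exists x0 : n.-tuple X,
      forall i : 'I_n, phi_le G phi (tnth x0 i) (Frot F x0 i)) :
  exists x : n.-tuple X, common_tuple_fixed_point F g x.
Proof.
have [x0 x0le] := x0_exists.
pose Phi (x : n.-tuple X) := [tuple Frot F x i | i < n].
pose a k := iter k (fun x => [tuple of map g (Phi x)]) x0.
have aS k i : tnth (a k.+1) i = g (Frot F (a k) i).
  by rewrite /a iterS tnth_map tnth_mktuple.
have Phi_le k i : phi_le G phi (Frot F (a k) i) (tnth (a k.+1) i).
  by rewrite aS; exact: (Fg_related (a k) i).1.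
have le_Phi k i : phi_le G phi (tnth (a k) i) (Frot F (a k) i).
  case: k => [|k]; first exact: x0le.
  (* The second half of weak relatedness is taken at [Phi (a k)], whose image under [g] is
     [a k.+1]. *)
  by have := (Fg_related (Phi (a k)) i).2; rewrite aS tnth_mktuple.
have a_incr i k : phi_le G phi (tnth (a k) i) (tnth (a k.+1) i).
  exact: phi_le_trans (le_Phi k i) (Phi_le k i).
have /choice[x ax] i : exists y, Gcvg G (fun k => tnth (a k) i) y.
  exact/G_complete/(phi_chain_cauchy G_metric phi_bounded (a_incr i)).
exists [tuple x i | i < n] => i; rewrite tnth_mktuple.
have Phi_cvg : Gcvg G (fun k => Frot F (a k) i) (Frot F [tuple x j | j < n] i).
  by apply: F_cont => j; rewrite tnth_mktuple.
have xPhi : x i = Frot F [tuple x j | j < n] i.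
  exact: (phi_chain_between G_metric phi_bounded (a_incr i) (le_Phi^~ i)
            (Phi_le^~ i) (ax i) Phi_cvg).
have gx : g (x i) = x i.
  (* The sequence [g (Frot F (a k) i)] tends to [g (x i)] by continuity, and to [x i] because it is
     the shifted orbit. *)
  rewrite {1}xPhi; apply: Gcvg_unique (g_cont _ _ Phi_cvg) _ => //.
  rewrite (_ : _ \o _ = fun k => tnth (a k.+1) i); last by apply/funext => k.
  exact: (Gcvg_shift G_metric (ax i)).
by rewrite gx -xPhi.
Qed.
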